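(* Let $R$ be a ring and let $\mathcal{F}$ be a right Oka family in $R$ such that every nonempty chain (with respect to inclusion) of right ideals in $\mathcal{F}'$ has an upper bound in $\mathcal{F}'$, where $\mathcal{F}'$ is the set of right ideals of $R$ not belonging to $\mathcal{F}$ (for example, this chain condition holds if every right ideal in $\mathcal{F}$ is finitely generated). Let $\mathcal{S}$ denote the set of completely prime right ideals of $R$. (1) Let $\mathcal{F}_0$ be a semifilter of right ideals in $R$. If $\mathcal{S}\cap\mathcal{F}_0\subseteq\mathcal{F}$, then $\mathcal{F}_0\subseteq\mathcal{F}$. (2) For a right ideal $J$ of $R$, if all right ideals in $\mathcal{S}$ containing $J$ (respectively, properly containing $J$) belong to $\mathcal{F}$, then all right ideals of $R$ containing $J$ (respectively, properly containing $J$) belong to $\mathcal{F}$. (3) If $\mathcal{S}\subseteq\mathcal{F}$, then all right ideals of $R$ belong to $\mathcal{F}$.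
   Context: Rings are associative with $1$, not necessarily commutative. For a right ideal $I$ of $R$ and $a\in R$, put $a^{-1}I:=\{r\in R: ar\in I\}$, a right ideal of $R$. A right Oka family in $R$ is a family $\mathcal{F}$ of right ideals of $R$ with $R\in\mathcal{F}$ such that for every right ideal $I$ of $R$ and every $a\in R$: if $I+aR\in\mathcal{F}$ and $a^{-1}I\in\mathcal{F}$, then $I\in\mathcal{F}$. A right ideal $P\subsetneq R$ is completely prime if for all $a,b\in R$ with $aP\subseteq P$, $ab\in P$ implies $a\in P$ or $b\in P$. A semifilter of right ideals in $R$ is a family $\mathcal{F}_0$ of right ideals such that for all right ideals $I,J$ of $R$, if $I\in\mathcal{F}_0$ and $J\supseteq I$ then $J\in\mathcal{F}_0$. *)

(* Defs.v *)
From HB Require Import structures.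
From mathcomp Require Import all_boot all_order all_algebra.
From mathcomp Require Import boolp classical_sets.

Set Implicit Arguments.
Unset Strict Implicit.
Unset Printing Implicit Defensive.

Import GRing.Theory.
Local Open Scope classical_set_scope.
Local Open Scope ring_scope.

(* A ring is a [pzRingType], so the zero ring is included.  A family of right
   ideals is a set of subsets all of whose members satisfy [right_ideal]. *)

Definition right_ideal (R : pzRingType) (I : set R) : Prop :=
  [/\ I 0,
      forall x y, I x -> I y -> I (x - y)
    & forall x r, I x -> I (x * r)].

Definition rideal_colon (R : pzRingType) (a : R) (I : set R) : set R :=
  [set r | I (a * r)].

Definition rideal_add (R : pzRingType) (I : set R) (a : R) : set R :=
  [set x + a * r | x in I & r in [set: R]].

Definition right_oka_family (R : pzRingType) (F : set (set R)) : Prop :=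
  [/\ F `<=` @right_ideal R,
      F [set: R]
    & forall (I : set R) (a : R), right_ideal I ->
        F (rideal_add I a) -> F (rideal_colon a I) -> F I].

Definition completely_prime (R : pzRingType) (P : set R) : Prop :=
  [/\ right_ideal P,
      P `<` [set: R]
    & forall a b : R, (forall p, P p -> P (a * p)) ->
        P (a * b) -> P a \/ P b].

Definition semifilter (R : pzRingType) (F0 : set (set R)) : Prop :=
  F0 `<=` @right_ideal R /\
  forall I J : set R, right_ideal J -> F0 I -> I `<=` J -> F0 J.

Definition rideal_compl (R : pzRingType) (F : set (set R)) : set (set R) :=
  [set I | right_ideal I /\ ~ F I].

Definition chains_bounded (R : pzRingType) (G : set (set R)) : Prop :=
  forall C : set (set R), C `<=` G -> C !=set0 -> total_on C subset ->
    exists2 U : set R, G U & forall I, C I -> I `<=` U.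

Definition finitely_generated (R : pzRingType) (I : set R) : Prop :=
  exists s : seq R, I = smallest (@right_ideal R) [set` s].

(* Main.v *)
Require Import Defs.
From HB Require Import structures.
From mathcomp Require Import all_boot all_order all_algebra.
From mathcomp Require Import boolp classical_sets.
Set Implicit Arguments.
Unset Strict Implicit.
Unset Printing Implicit Defensive.
Import GRing.Theory.
Local Open Scope classical_set_scope.
Local Open Scope ring_scope.

(** The statement rests on the prime ideal principle: a right ideal [P] that is
    maximal among those outside a right Oka family [F] is completely prime
    ([maximal_compl_completely_prime]).  Indeed, if [aP] is contained in [P]
    and [ab] lies in [P] while neither [a] nor [b] does, then both [P + aR] and
    [a^-1 P] strictly contain [P] (the first contains [a]; the second contains
    [P] because [aP] does not leave [P], and it contains [b]).  By maximality
    both belong to [F], and the Oka property puts [P] in [F], which is absurd.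

    Under the chain condition, Zorn's lemma places every right ideal [I] outside
    [F] below such a maximal one, so [I] is contained in a completely prime right
    ideal outside [F] ([compl_sub_completely_prime]).  The three conclusions
    follow by contraposition: membership in a semifilter, containing [J], and
    strictly containing [J] all pass from [I] to the larger ideal.

    When the members of [F] are finitely generated, the upper bound of a chain
    outside [F] is its union [U]: were [U] in [F], its finitely many generators
    would already lie in one member of the chain, which would then be [U]. *)

(** * Right ideals *)

Lemma right_ideal_colon (R : pzRingType) (a : R) (I : set R) :
  right_ideal I -> right_ideal (rideal_colon a I).
Proof.
move=> [I0 IB IM]; split; rewrite /rideal_colon /= ?mulr0 //.
- by move=> x y Ix Iy; rewrite mulrBr; exact: IB.
- by move=> x r Ix; rewrite mulrA; exact: IM.
Qed.

Lemma right_ideal_rideal_add (R : pzRingType) (I : set R) (a : R) :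
  right_ideal I -> right_ideal (rideal_add I a).
Proof.
move=> [I0 IB IM]; split.
- by exists 0 => //; exists 0; rewrite // mulr0 addr0.
- move=> _ _ [x Ix [r _ <-]] [y Iy [s _ <-]].
  exists (x - y); first exact: IB.
  by exists (r - s); rewrite // mulrBr opprD addrACA.
- move=> _ s [x Ix [r _ <-]]; exists (x * s); first exact: IM.
  by exists (r * s); rewrite // mulrDl mulrA.
Qed.

Lemma sub_rideal_add (R : pzRingType) (I : set R) (a : R) :
  I `<=` rideal_add I a.
Proof. by move=> x Ix; exists x => //; exists 0; rewrite // mulr0 addr0. Qed.

Lemma mem_rideal_add (R : pzRingType) (I : set R) (a : R) :
  right_ideal I -> rideal_add I a a.
Proof. by move=> [I0 _ _]; exists 0 => //; exists 1; rewrite // mulr1 add0r. Qed.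

(** * Chains of sets and of right ideals *)

Lemma chain_seq_sub (T : eqType) (C : set (set T)) (s : seq T) :
  C !=set0 -> total_on C subset -> [set` s] `<=` \bigcup_(I in C) I ->
  exists2 I, C I & [set` s] `<=` I.
Proof.
move=> [I0 CI0] totC; elim: s => [_|x s IHs sC]; first by exists I0.
have [|I CI sI] := IHs.
  by move=> y ys; apply: sC; rewrite /= inE (ys : y \in s) orbT.
have [|K CK Kx] := sC x; first by rewrite /= mem_head.
have [IK|KI] := totC _ _ CI CK.
- exists K => // y; rewrite /= inE => /predU1P[->//|ys].
  exact/IK/sI.
- exists I => // y; rewrite /= inE => /predU1P[->|ys]; first exact: KI.
  exact: sI.
Qed.

Lemma right_ideal_chain_bigcup (R : pzRingType) (C : set (set R)) :
  C `<=` @right_ideal R -> C !=set0 -> total_on C subset ->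
  right_ideal (\bigcup_(I in C) I).
Proof.
move=> Cr [I0 CI0] totC; split.
- by exists I0 => //; case: (Cr _ CI0).
- move=> x y [I CI Ix] [K CK Ky].
  have [IK|KI] := totC _ _ CI CK.
  + by exists K => //; have [_ KB _] := Cr _ CK; apply: KB => //; exact: IK.
  + by exists I => //; have [_ IB _] := Cr _ CI; apply: IB => //; exact: KI.
- by move=> x r [I CI Ix]; exists I => //; have [_ _ IM] := Cr _ CI; exact: IM.
Qed.

Lemma finitely_generated_chains_bounded (R : pzRingType) (F : set (set R)) :
  (forall I, F I -> finitely_generated I) -> chains_bounded (rideal_compl F).
Proof.
move=> Ffg C CF C0 totC; pose U := \bigcup_(I in C) I.
exists U; last by move=> I CI; exact: bigcup_sup.
split; first by apply: right_ideal_chain_bigcup => // I /CF[].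
move=> FU; have [s Us] := Ffg _ FU.
have [|I CI sI] := @chain_seq_sub _ _ s C0 totC.
  by rewrite -/U Us; exact: sub_gen_smallest.
have [Ir nFI] := CF _ CI; apply: nFI; suff -> : I = U by [].
apply/seteqP; split; first exact: bigcup_sup.
by rewrite Us; exact: smallest_sub.
Qed.

(** The bound is only required for nonempty chains; an empty chain of sets
    containing [I] is bounded by [I] itself. *)
Lemma chains_bounded_maximal (R : pzRingType) (G : set (set R)) (I : set R) :
  chains_bounded G -> G I ->
  exists P, [/\ G P, I `<=` P & forall K, G K -> P `<=` K -> K `<=` P].
Proof.
move=> chG GI; pose T := {K : set R | G K /\ I `<=` K}.
pose I0 : T := exist _ I (conj GI (@subset_refl _ I)).
pose le (X Y : T) := `[< sval X `<=` sval Y >].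
have [|||[P [GP IP]] Pmax] := @ZL_preorder T I0 le.
- by move=> X; apply/asboolP.
- by move=> X Y Z /asboolP XY /asboolP YZ; apply/asboolP; exact: subset_trans YZ.
- move=> A totA; have [[X0 AX0]|A0] := pselect (A !=set0); last first.
    by exists I0 => X AX; case: A0; exists X.
  have [|||U GU Uub] := chG [set sval X | X in A].
  + by move=> _ [X _ <-]; case: (svalP X).
  + by exists (sval X0), X0.
  + move=> _ _ [X AX <-] [Y AY <-].
    by have [/asboolP|/asboolP] := totA _ _ AX AY; [left|right].
  + have IU : I `<=` U.
      by apply: subset_trans (Uub _ _); [exact: (svalP X0).2|exists X0].
    by exists (exist _ U (conj GU IU)) => X AX; apply/asboolP/Uub; exists X.
- exists P; split=> // K GK PK.
  pose KT : T := exist _ K (conj GK (subset_trans IP PK)).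
  by apply/asboolP/(Pmax KT); apply/asboolP.
Qed.

(** * Right ideals maximal outside a right Oka family *)

(** If [a] and [b] witness the failure of complete primeness, then [P + aR] and
    [a^-1 P] strictly contain [P], hence lie in [F], and so does [P]. *)
Lemma maximal_compl_completely_prime (R : pzRingType) (F : set (set R))
    (P : set R) :
  right_oka_family F -> rideal_compl F P ->
  (forall K, rideal_compl F K -> P `<=` K -> K `<=` P) ->
  completely_prime P.
Proof.
move=> [_ FT okaF] [Pr nFP] Pmax.
have F_above K x : right_ideal K -> P `<=` K -> K x -> ~ P x -> F K.
  by move=> Kr PK Kx nPx; apply: contrapT => nFK; apply/nPx/(Pmax K).
split=> //.
- by rewrite properEneq; split=> //; apply/eqP => PT; apply: nFP; rewrite PT.
- move=> a b aP Pab; apply: contrapT => /not_orP[nPa nPb].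
  apply/nFP/(okaF P a) => //.
  + apply: (F_above _ a) => //; first exact: right_ideal_rideal_add.
      exact: sub_rideal_add.
    exact: mem_rideal_add.
  + exact: (F_above _ b (right_ideal_colon a Pr)).
Qed.

Lemma compl_sub_completely_prime (R : pzRingType) (F : set (set R))
    (I : set R) :
  right_oka_family F -> chains_bounded (rideal_compl F) ->
  rideal_compl F I ->
  exists P, [/\ completely_prime P, I `<=` P & ~ F P].
Proof.
move=> okaF chF /(chains_bounded_maximal chF)[P [FP IP Pmax]].
exists P; split=> //; last by case: FP.
exact: maximal_compl_completely_prime Pmax.
Qed.

Theorem theorem3p6 (R : pzRingType) (F : set (set R))
    (okaF : right_oka_family F) :
  ((forall I : set R, F I -> finitely_generated I) ->
     chains_bounded (rideal_compl F)) /\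
  (chains_bounded (rideal_compl F) ->
    [/\ forall F0 : set (set R), semifilter F0 ->
          @completely_prime R `&` F0 `<=` F -> F0 `<=` F,
        forall J : set R, right_ideal J ->
          ((forall P : set R, completely_prime P -> J `<=` P -> F P) ->
             forall I : set R, right_ideal I -> J `<=` I -> F I) /\
          ((forall P : set R, completely_prime P -> J `<` P -> F P) ->
             forall I : set R, right_ideal I -> J `<` I -> F I)
      & @completely_prime R `<=` F ->
          forall I : set R, right_ideal I -> F I]).
Proof.
split; first exact: finitely_generated_chains_bounded.
move=> chF.
(* A property of right ideals that passes to larger ones need only be
   tested on completely prime right ideals. *)
have upward (Q : set R -> Prop) :
    (forall I P, right_ideal P -> Q I -> I `<=` P -> Q P) ->
    (forall P, completely_prime P -> Q P -> F P) ->
    forall I, right_ideal I -> Q I -> F I.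
  move=> Qup QF I Ir QI; apply: contrapT => nFI.
  have [P [Pcp IP nFP]] := compl_sub_completely_prime okaF chF (conj Ir nFI).
  by apply/nFP/QF => //; apply: Qup IP => //; case: Pcp.
split.
- move=> F0 [F0r F0up] SF0 I F0I.
  apply: (upward F0) (F0r _ F0I) F0I; first exact: F0up.
  by move=> P Pcp F0P; exact: SF0.
- move=> J _; split=> SF; apply: upward SF.
  + by move=> I P _ JI IP; exact: subset_trans IP.
  + move=> I P _ [JI nIJ] IP; split; first exact: subset_trans IP.
    by move=> PJ; apply: nIJ; exact: subset_trans PJ.
- by move=> SF I Ir; apply: (upward setT) => // P Pcp _; exact: SF.
Qed.
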